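(* Let $P\subset\mathbb R^2$ be a convex lattice polygon with nonzero area $A(P)$, and let $l=\operatorname{ls}_\Delta(P)$. Then $A(P)\ge \frac12 l$. Equality holds exactly when $P$ is lattice-equivalent to one of: (a) $\operatorname{conv}\{(0,0),(l,0),(0,1)\}$ (for $l\ge1$); (b) $[0,1]^2$ (when $l=2$); (c) $\operatorname{conv}\{(0,0),(1,2),(2,1)\}$ (when $l=3$).
   Context: A lattice polygon is a convex polygon all of whose vertices lie in $\mathbb Z^2$. An affine unimodular transformation is $x\mapsto Ax+v$ with $A\in\mathbb Z^{2\times2}$, $\det A=\pm1$, $v\in\mathbb Z^2$; two sets are lattice-equivalent if one is the image of the other under such a map. With $\Delta=\operatorname{conv}\{(0,0),(1,0),(0,1)\}$, $\operatorname{ls}_\Delta(P)$ is the smallest $l\ge0$ such that $\varphi(P)\subseteq l\Delta$ for some affine unimodular $\varphi$. *)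

(* Defs.v *)
From HB Require Import structures.
From mathcomp Require Import all_boot all_order all_algebra.
From mathcomp Require Import all_classical all_reals all_analysis.
Set Implicit Arguments. Unset Strict Implicit. Unset Printing Implicit Defensive.
Import Order.TTheory GRing.Theory Num.Theory.
Local Open Scope classical_set_scope.
Local Open Scope ring_scope.

Section Defs.
Variable R : realType.

Definition pt (x y : R) : R * R := (x, y).

Definition zpt (z : int * int) : R * R := (z.1%:~R, z.2%:~R).

Definition hull (V : seq (R * R)) : set (R * R) :=
  [set p | exists w : 'I_(size V) -> R,
      (forall i, 0 <= w i) /\ \sum_(i < size V) w i = 1 /\
      p = (\sum_(i < size V) w i * (nth (0, 0) V i).1,
           \sum_(i < size V) w i * (nth (0, 0) V i).2)].

Definition lattice_polygon (P : set (R * R)) : Prop :=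
  exists V : seq (int * int), V != [::] /\ P = hull (map zpt V).

Definition unimodular (A : 'M[int]_2) : Prop :=
  \det A = 1 \/ \det A = -1.

Definition aff (A : 'M[int]_2) (v : int * int) (p : R * R) : R * R :=
  ((A 0 0)%:~R * p.1 + (A 0 1)%:~R * p.2 + v.1%:~R,
   (A 1 0)%:~R * p.1 + (A 1 1)%:~R * p.2 + v.2%:~R).

Definition lattice_equiv (P Q : set (R * R)) : Prop :=
  exists (A : 'M[int]_2) (v : int * int), unimodular A /\ aff A v @` P = Q.

(* l * Delta, Delta = hull{(0,0),(1,0),(0,1)}. *)
Definition scaled_Delta (l : R) : set (R * R) :=
  [set p | 0 <= p.1 /\ 0 <= p.2 /\ p.1 + p.2 <= l].

Definition ls_Delta (P : set (R * R)) : R :=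
  inf [set l | 0 <= l /\ exists (A : 'M[int]_2) (v : int * int),
                 unimodular A /\ aff A v @` P `<=` scaled_Delta l].

Definition area2 (P : set (R * R)) : \bar R :=
  ((@lebesgue_measure R) \x (@lebesgue_measure R))%E P.

End Defs.

(* Main.v *)
Require Import Defs.
From HB Require Import structures.
From mathcomp Require Import all_boot all_order all_algebra.
From mathcomp Require Import all_classical all_reals all_analysis.
From mathcomp Require Import measurable_realfun.
From mathcomp Require Import zify ring lra.
Import Order.TTheory GRing.Theory Num.Theory.
Local Open Scope classical_set_scope.
Local Open Scope ring_scope.

(** Choose unimodular coordinates in which the polygon has minimal lattice
    width [w], lying in [0 <= y <= w] with the vertices [(0,0)] and [(j,w)],
    [0 <= j < w]. If [w x - j y] ranges over [-b, a] on [P] and [n = a + b], the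
    quadrilateral spanned by these two vertices and the two extremal points of
    [w x - j y] has normalized area [n], so [2 A(P) >= n]. On the other hand
    [x <= a/w + j] and [x - y >= -b/w - (w - j)], so the coordinates
    [(max x - x, y)] show that [l <= n/w + w]. Minimality of the width, applied
    to [x] and [x - y], gives [2 n >= w^2]. Hence [l < n] for [w >= 3]; the
    equality cases come from [w = 1] (trapezoids) and [w = 2] (finitely many
    configurations of lattice points).

    The area is invariant under affine maps of determinant [1] and [-1] because
    these are products of shears and of the exchange of coordinates: a shear
    translates the vertical sections, and the exchange is Fubini. *)

Set Implicit Arguments. Unset Strict Implicit. Unset Printing Implicit Defensive.

(** * Lattice polygons in normal form *)

Definition zaff (a b c d e f : int) (z : int * int) : int * int :=
  (a * z.1 + b * z.2 + e, c * z.1 + d * z.2 + f).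

(** The integer counterpart of [aff] with a unimodular matrix. Pointwise equality lets [id] and
    compositions qualify directly. *)
Definition unimap (phi : int * int -> int * int) :=
  exists a b c d e f : int,
    (a * d - b * c = 1 \/ a * d - b * c = -1) /\ phi =1 zaff a b c d e f.

(** Twice the signed area of the triangle [p q r], positive for counterclockwise order. *)
Definition orient (p q r : int * int) : int :=
  (q.1 - p.1) * (r.2 - p.2) - (q.2 - p.2) * (r.1 - p.1).

Lemma zaff_unimap a b c d e f :
  a * d - b * c = 1 \/ a * d - b * c = -1 -> unimap (zaff a b c d e f).
Proof. by move=> h; exists a, b, c, d, e, f. Qed.

Lemma unimap_id : unimap id.
Proof.
by exists 1, 0, 0, 1, 0, 0; split; [lia | move=> [x y]; congr (_, _) => /=; lia].
Qed.

Lemma unimap_comp phi psi : unimap phi -> unimap psi -> unimap (psi \o phi).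
Proof.
move=> [a [b [c [d [e [f [h1 E1]]]]]]] [a' [b' [c' [d' [e' [f' [h2 E2]]]]]]].
exists (a' * a + b' * c), (a' * b + b' * d), (c' * a + d' * c), (c' * b + d' * d),
  (a' * e + b' * f + e'), (c' * e + d' * f + f'); split; last first.
  by move=> [x y] /=; rewrite E1 E2 /zaff /=; congr (_, _); ring.
have -> : (a' * a + b' * c) * (c' * b + d' * d) - (a' * b + b' * d) * (c' * a + d' * c)
   = (a' * d' - b' * c') * (a * d - b * c) by ring.
by case: h1 => ->; case: h2 => ->; [left|right|right|left].
Qed.

Lemma orient_unimap phi : unimap phi ->
  (forall p q r, orient (phi p) (phi q) (phi r) = orient p q r) \/
  (forall p q r, orient (phi p) (phi q) (phi r) = - orient p q r).
Proof.
move=> [a [b [c [d [e [f [h E]]]]]]].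
have H p q r : orient (phi p) (phi q) (phi r) = (a * d - b * c) * orient p q r.
  by rewrite !E /orient /zaff /=; ring.
by case: h => h; [left|right] => p q r; rewrite H h ?mul1r ?mulN1r.
Qed.

Definition flat (W : seq (int * int)) := forall x y : int, (x, y) \in W -> y = 0.

Definition in_zDelta (L : int) (z : int * int) :=
  0 <= z.1 /\ 0 <= z.2 /\ z.1 + z.2 <= L.

(* The quadrilateral [p s q r] with diagonal [pq] has normalized area
   [orient p q r - orient p q s]. *)
Definition thick (W : seq (int * int)) :=
  exists L p q r s, p \in W /\ q \in W /\ r \in W /\ s \in W /\
    (forall z, z \in W -> in_zDelta L z) /\
    0 <= orient p q r /\ orient p q s <= 0 /\
    L < orient p q r - orient p q s.

Definition thin (W : seq (int * int)) := exists2 k : int, 1 <= k &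
  [/\ (0, 0) \in W, (k, 0) \in W, (0, 1) \in W &
      forall x y : int, (x, y) \in W -> 0 <= x /\ 0 <= y /\ x + k * y <= k].

Definition square (W : seq (int * int)) :=
  [/\ (0, 0) \in W, (1, 0) \in W, (0, 1) \in W, (1, 1) \in W &
      forall x y : int, (x, y) \in W -> 0 <= x <= 1 /\ 0 <= y <= 1].

(** Besides the vertices, the centroid [(1, 1)] is the only lattice point of this triangle. *)
Definition central (W : seq (int * int)) :=
  [/\ (0, 0) \in W, (1, 2) \in W, (2, 1) \in W &
      forall z, z \in W -> z \in [:: (0, 0); (1, 1); (1, 2); (2, 1) : int * int]].

(** [flat] excludes positive area and [thick] forces the strict inequality; the other three are the
    equality families (a), (b), (c). *)
Definition normal_form W := flat W \/ thick W \/ thin W \/ square W \/ central W.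

Definition has_normal_form V := exists2 phi, unimap phi & normal_form (map phi V).

Lemma has_normal_form_map phi V :
  unimap phi -> has_normal_form (map phi V) -> has_normal_form V.
Proof.
move=> uphi [psi upsi h]; exists (psi \o phi); first exact: unimap_comp.
by rewrite map_comp.
Qed.

Lemma has_normal_form_id W : normal_form W -> has_normal_form W.
Proof. by move=> h; exists id; [exact: unimap_id | rewrite map_id]. Qed.

(** A map of determinant -1 negates orientations, so [r] and [s] trade places. Hence areas are
    evaluated in the coordinates of [W], while [psi] is chosen only to fit [W] into a dilated
    standard triangle. *)
Lemma has_normal_form_thick psi L p q r s W : unimap psi ->
  p \in W -> q \in W -> r \in W -> s \in W ->
  (forall x y : int, (x, y) \in W -> in_zDelta L (psi (x, y))) ->
  0 <= orient p q r -> orient p q s <= 0 ->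
  L < orient p q r - orient p q s -> has_normal_form W.
Proof.
move=> u pW qW rW sW hL h1 h2 h3; exists psi => //; right; left.
have hL' z : z \in map psi W -> in_zDelta L z.
  by move=> /mapP[[x y] /hL + ->].
case: (orient_unimap u) => H.
  by exists L, (psi p), (psi q), (psi r), (psi s); rewrite !map_f // !H.
exists L, (psi p), (psi q), (psi s), (psi r); rewrite !map_f // !H.
do 5!split => //; lia.
Qed.

(** * Extremal points and lattice width *)

Lemma seq_argmax (T : eqType) (f : T -> int) (s : seq T) x0 : x0 \in s ->
  exists2 x, x \in s & forall y, y \in s -> f y <= f x.
Proof.
elim: s x0 => // a s IH x0 _.
case: s IH => [_|b s IH].
  by exists a; rewrite ?mem_head // => y; rewrite inE => /eqP ->.
have [x xs hx] := IH b (mem_head _ _).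
case: (lerP (f a) (f x)) => h.
  exists x; first by rewrite inE xs orbT.
  by move=> y; rewrite inE => /predU1P[->|/hx].
exists a; first exact: mem_head.
by move=> y; rewrite inE => /predU1P[->|/hx] //; lia.
Qed.

Lemma seq_argmin (T : eqType) (f : T -> int) (s : seq T) x0 : x0 \in s ->
  exists2 x, x \in s & forall y, y \in s -> f x <= f y.
Proof.
by move=> /(seq_argmax (fun x => - f x))[x xs h]; exists x => // y /h; lia.
Qed.

(** Lattice width at least [w]: a suitable [psi] turns any primitive integral linear form into the
    second coordinate. *)
Definition wide (w : int) (W : seq (int * int)) := forall psi, unimap psi ->
  exists z z', [/\ z \in W, z' \in W & (psi z).2 + w <= (psi z').2].

Lemma wide_map phi w W : unimap phi -> wide w W -> wide w (map phi W).
Proof.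
move=> u h psi upsi; have [z [z' [zW zW' le]]] := h _ (unimap_comp u upsi).
by exists (phi z), (phi z'); rewrite !map_f.
Qed.

Lemma wide_shear w W k : wide w W -> exists x y x' y' : int,
  [/\ (x, y) \in W, (x', y') \in W & x - k * y + w <= x' - k * y'].
Proof.
have u : unimap (zaff 0 1 1 (- k) 0 0) by apply: zaff_unimap; lia.
move=> /(_ _ u)[[x y] [[x' y'] [zW zW' /= le]]]; exists x, y, x', y'.
by split=> //; lia.
Qed.

(** * Normal forms according to the lattice width *)

(** The normalized area is [al + be], and the trapezoid fits into size [al + be - 1] unless [be = 0]
    or [al = be = 1]. *)
Lemma has_normal_form_trapezoid (al be : int) W : 0 <= be <= al ->
  (0, 0) \in W -> (al, 0) \in W -> (0, 1) \in W -> (be, 1) \in W ->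
  (forall x y : int, (x, y) \in W ->
     (y = 0 /\ 0 <= x <= al) \/ (y = 1 /\ 0 <= x <= be)) -> has_normal_form W.
Proof.
move=> ab W00 Wa W01 Wb HW.
have [be0|be0] : be = 0 \/ 1 <= be by lia.
  have [al0|al0] : al = 0 \/ 1 <= al by lia.
    (* Only a vertical segment is left; exchanging the coordinates makes it flat. *)
    exists (zaff 0 1 1 0 0 0); first by apply: zaff_unimap; lia.
    by left=> x y /mapP[[x' y'] /HW h [_ ->]] /=; lia.
  apply: has_normal_form_id; right; right; left; exists al => //; split=> // x y /HW.
  by case=> [[-> ?]|[-> ?]]; lia.
have [al1|al1] : al = 1 \/ 2 <= al by lia.
  have be1 : be = 1 by lia.
  subst al be; apply: has_normal_form_id; do 3!right; left; split=> // x y /HW; lia.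
apply: (@has_normal_form_thick id (al + be - 1) (al, 0) (0, 1) (0, 0) (be, 1)) => //.
- exact: unimap_id.
- by move=> x y /HW; rewrite /in_zDelta /=; lia.
- by rewrite /orient /=; lia.
- by rewrite /orient /=; lia.
- by rewrite /orient /=; lia.
Qed.

(** Without one corner, the lattice points of a 2 by 2 box fit into size 3 after a reflection, below
    the given area 4. With all corners the normalized area is 8 and size 4 suffices. *)
Lemma has_normal_form_box2 (m : int) (W : seq (int * int)) :
  (0, 0) \in W -> (0, 2) \in W ->
  (forall x y : int, (x, y) \in W -> m <= x <= m + 2 /\ 0 <= y <= 2) ->
  (exists p r s, [/\ p \in W, r \in W, s \in W & [/\ orient (0, 0) p r >= 0,
     orient (0, 0) p s <= 0 & orient (0, 0) p r - orient (0, 0) p s >= 4]]) ->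
  has_normal_form W.
Proof.
move=> W0 W2 HW [p [r [s [pW rW sW [h1 h2 h3]]]]].
have corner (c : int * int) psi : unimap psi -> c \notin W ->
  (forall x y : int, m <= x <= m + 2 -> 0 <= y <= 2 -> (x, y) != c ->
     in_zDelta 3 (psi (x, y))) -> has_normal_form W.
  move=> u cW h; apply: (@has_normal_form_thick psi 3 (0, 0) p r s) => //.
  move=> x y xyW; have [hx hy] := HW _ _ xyW; apply: h => //.
  by apply: contraNneq cW => <-.
have [c1|] := boolP ((m + 2, 2) \in W); last first.
  move/(corner _ (zaff 1 0 0 1 (- m) 0)); apply; first by apply: zaff_unimap; lia.
  by move=> x y hx hy; rewrite xpair_eqE /in_zDelta /=; lia.
have [c2|] := boolP ((m, 2) \in W); last first.
  move/(corner _ (zaff (-1) 0 0 1 (m + 2) 0)); apply; first by apply: zaff_unimap; lia.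
  by move=> x y hx hy; rewrite xpair_eqE /in_zDelta /=; lia.
have [c3|] := boolP ((m + 2, 0) \in W); last first.
  move/(corner _ (zaff 1 0 0 (-1) (- m) 2)); apply; first by apply: zaff_unimap; lia.
  by move=> x y hx hy; rewrite xpair_eqE /in_zDelta /=; lia.
have [c4|] := boolP ((m, 0) \in W); last first.
  move/(corner _ (zaff (-1) 0 0 (-1) (m + 2) 2)); apply;
    first by apply: zaff_unimap; lia.
  by move=> x y hx hy; rewrite xpair_eqE /in_zDelta /=; lia.
apply: (@has_normal_form_thick (zaff 1 0 0 1 (- m) 0) 4
          (m, 0) (m + 2, 2) (m, 2) (m + 2, 0)) => //.
- by apply: zaff_unimap; lia.
- by move=> x y /HW; rewrite /in_zDelta /=; lia.
- by rewrite /orient /=; lia.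
- by rewrite /orient /=; lia.
- by rewrite /orient /=; lia.
Qed.

(** The case [w = 2], [j = 1]. Either [W] fits into size 3 and spans normalized area at least 4, or
    it fits into size 4 and spans 8, or it is the exceptional triangle. *)
Lemma has_normal_form_skew2 (a b : int) W : wide 2 W -> b <= a -> a + b <= 4 ->
  (0, 0) \in W -> (1, 2) \in W ->
  (forall x y : int, (x, y) \in W -> - b <= 2 * x - y <= a /\ 0 <= y <= 2) ->
  (exists x y : int, (x, y) \in W /\ 2 * x - y = a) ->
  (exists x y : int, (x, y) \in W /\ 2 * x - y = - b) -> has_normal_form W.
Proof.
move=> wW ba ab W00 W12 HW [xa [ya [aW Ea]]] [xb [yb [bW Eb]]].
have [b0 a0] : 0 <= b /\ 0 <= a by have := HW _ _ W00; lia.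
have [x [y [x' [y' [zW z'W le]]]]] := wide_shear 0 wW.
have [u [v [u' [v' [tW t'W le']]]]] := wide_shear 1 wW.
have h := HW _ _ zW; have h' := HW _ _ z'W.
have k := HW _ _ tW; have k' := HW _ _ t'W.
have hA := HW _ _ aW; have hB := HW _ _ bW.
have uR : unimap (zaff (-1) 0 0 1 2 0) by apply: zaff_unimap; lia.
have notin (c : int * int) (x1 y1 : int) : c \notin W -> (x1, y1) \in W ->
  ~ (x1 = c.1 /\ y1 = c.2).
  by case: c => c1 c2 /= cW W1 [e1 e2]; subst; rewrite W1 in cW.
(* Here [(2, 2)] is the only candidate with [x = 2], and [(1, 0)] the only one with [x - y = 1];
   width 2 forces both into [W]. *)
have [[a2 b1]|a2] : (a = 2 /\ b <= 1) \/ ~ (a = 2 /\ b <= 1) by lia.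
  have [e1 e2] : x' = 2 /\ y' = 2 by lia.
  have [e3 e4] : u' = 1 /\ v' = 0 by lia.
  subst x' y' u' v'.
  apply: (@has_normal_form_thick _ 3 (0, 0) (2, 2) (1, 2) (1, 0) W uR) => //.
  by move=> x1 y1 /HW; rewrite /in_zDelta /=; lia.
(* For [a <= 1] the coordinate [x] takes only the values 0 and 1, against width 2; then [a + b <= 4]
   leaves four pairs. *)
have {x y x' y' zW z'W le u v u' v' tW t'W le' h h' k k'} a3 :
    a = 3 /\ b = 0 \/ a = 4 /\ b = 0 \/ a = 3 /\ b = 1 \/ a = 2 /\ b = 2 by lia.
have ob : orient (0, 0) (1, 2) (xb, yb) = b by rewrite /orient /=; lia.
have oa : orient (0, 0) (1, 2) (xa, ya) = - a by rewrite /orient /=; lia.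
case: a3 => [|[|[]]] [ea eb].
(* Parity of [2 * x - y = 3] forces the point [(2, 1)]. Adding [(1, 0)] or [(2, 2)] raises the
   normalized area to 4; without them only the lattice points of the exceptional triangle remain. *)
- have [e1 e2] : xa = 2 /\ ya = 1 by lia.
  subst xa ya.
  have d3 (x1 y1 : int) : (x1, y1) \in W -> in_zDelta 3 (zaff (-1) 0 0 1 2 0 (x1, y1)).
    by move=> /HW; rewrite /in_zDelta /=; lia.
  have [c1|n1] := boolP ((1, 0) \in W).
    by apply: (@has_normal_form_thick _ 3 (1, 0) (1, 2) (0, 0) (2, 1) W uR).
  have [c2|n2] := boolP ((2, 2) \in W).
    by apply: (@has_normal_form_thick _ 3 (0, 0) (2, 2) (1, 2) (2, 1) W uR).
  apply: has_normal_form_id; do 4!right; split=> // -[x1 y1] W1.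
  have := notin _ _ _ n1 W1; have := notin _ _ _ n2 W1; have := HW _ _ W1.
  by rewrite !inE !xpair_eqE /=; lia.
(* Each of [(3, 2)] and [(2, 0)] is the sole obstruction to one embedding into size 3. If both
   occur, they complete a parallelogram of normalized area 8. *)
- have [c1|n1] := boolP ((3, 2) \in W); last first.
    apply: (has_normal_form_thick (L := 3) uR W00 W12 bW aW) => //; try lia.
    move=> x1 y1 W1; have := notin _ _ _ n1 W1; have := HW _ _ W1.
    by rewrite /in_zDelta /=; lia.
  have [c2|n2] := boolP ((2, 0) \in W); last first.
    apply: (@has_normal_form_thick (zaff 1 0 0 (-1) 0 2) 3
              (0, 0) (1, 2) (xb, yb) (xa, ya)) => //; try lia.
      by apply: zaff_unimap; lia.
    move=> x1 y1 W1; have := notin _ _ _ n2 W1; have := HW _ _ W1.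
    by rewrite /in_zDelta /=; lia.
  apply: (@has_normal_form_thick (zaff (-1) 0 0 1 3 0) 4
            (0, 0) (3, 2) (1, 2) (2, 0)) => //.
    by apply: zaff_unimap; lia.
  by move=> x1 y1 /HW; rewrite /in_zDelta /=; lia.
- apply: (has_normal_form_thick (L := 3) uR W00 W12 bW aW) => //; try lia.
  by move=> x1 y1 /HW; rewrite /in_zDelta /=; lia.
(* Each vertex of the parallelogram [(-1, 0), (1, 0), (2, 2), (0, 2)] is the sole obstruction to one
   embedding into size 3. *)
- have missing (c : int * int) psi : unimap psi -> c \notin W ->
    (forall x1 y1 : int, (x1, y1) \in W -> ~ (x1 = c.1 /\ y1 = c.2) ->
       in_zDelta 3 (psi (x1, y1))) -> has_normal_form W.
    move=> u0 cW H.
    apply: (has_normal_form_thick (L := 3) u0 W00 W12 bW aW) => //; try lia.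
    by move=> x1 y1 W1; apply: H => //; apply: notin.
  have [c1|] := boolP ((2, 2) \in W); last first.
    move/(missing _ (zaff (-1) 0 0 1 1 0)); apply; first by apply: zaff_unimap; lia.
    by move=> x1 y1 /HW; rewrite /in_zDelta /=; lia.
  have [c2|] := boolP ((0, 2) \in W); last first.
    move/(missing _ (zaff (-1) 0 0 1 2 0)); apply; first by apply: zaff_unimap; lia.
    by move=> x1 y1 /HW; rewrite /in_zDelta /=; lia.
  have [c3|] := boolP ((-1, 0) \in W); last first.
    move/(missing _ (zaff 1 0 0 (-1) 0 2)); apply; first by apply: zaff_unimap; lia.
    by move=> x1 y1 /HW; rewrite /in_zDelta /=; lia.
  have [c4|] := boolP ((1, 0) \in W); last first.
    move/(missing _ (zaff 1 0 0 (-1) 1 2)); apply; first by apply: zaff_unimap; lia.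
    by move=> x1 y1 /HW; rewrite /in_zDelta /=; lia.
  apply: (@has_normal_form_thick (zaff (-1) 0 0 1 2 0) 4
            (-1, 0) (2, 2) (0, 2) (1, 0)) => //.
  by move=> x1 y1 /HW; rewrite /in_zDelta /=; lia.
Qed.

Lemma has_normal_form_wide (w j : int) W : 2 <= w -> 0 <= j < w -> wide w W ->
  (0, 0) \in W -> (j, w) \in W ->
  (forall x y : int, (x, y) \in W -> 0 <= y <= w) -> has_normal_form W.
Proof.
move=> w2 jw wW W00 Wjw HW.
have [[xa ya] aW ha] := seq_argmax (fun z => w * z.1 - j * z.2) W00.
have [[xb yb] bW hb] := seq_argmin (fun z => w * z.1 - j * z.2) W00.
have [[xM yM] MW hM] := seq_argmax (fun z => z.1) W00.
have [[xm ym] mW hm] := seq_argmin (fun z => z.1 - z.2) W00.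
rewrite /= in ha hb hM hm.
pose a := w * xa - j * ya; pose b := j * yb - w * xb.
have a0 : 0 <= a by have := ha _ W00; rewrite /= /a; lia.
have b0 : 0 <= b by have := hb _ W00; rewrite /= /b; lia.
have Ha (x y : int) : (x, y) \in W -> w * x - j * y <= a by move/ha => /=.
have Hb (x y : int) : (x, y) \in W -> - b <= w * x - j * y.
  by move/hb => /=; rewrite /b; lia.
have ob : orient (0, 0) (j, w) (xb, yb) = b by rewrite /orient /b /=; lia.
have oa : orient (0, 0) (j, w) (xa, ya) = - a by rewrite /orient /a /=; lia.
(* On [W] one has [- b <= w * x <= a + w * j], so width [w] in the direction [x] gives the bound;
   [n2] is the same for [x - y]. *)
have n1 : w * (w - j) <= a + b.
  have [x [y [x' [y' [zW z'W le]]]]] := wide_shear 0 wW.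
  have := Hb _ _ zW; have := Ha _ _ z'W; have := HW _ _ zW; have := HW _ _ z'W.
  by nia.
have n2 : w * j <= a + b.
  have [x [y [x' [y' [zW z'W le]]]]] := wide_shear 1 wW.
  have := Hb _ _ zW; have := Ha _ _ z'W; have := HW _ _ zW; have := HW _ _ z'W.
  by nia.
(* In the coordinates [(xM - x, y)] the sum is [xM - (x - y)], at most [xM - (xm - ym)]. *)
have [big|small] := ltP (xM - (xm - ym)) (a + b).
  apply: (@has_normal_form_thick (zaff (-1) 0 0 1 xM 0) (xM - (xm - ym))
            (0, 0) (j, w) (xb, yb) (xa, ya)) => //; try lia.
    by apply: zaff_unimap; lia.
  move=> x y zW; have := hM _ zW; have := hm _ zW; have := HW _ _ zW.
  by rewrite /in_zDelta /=; lia.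
have le1 : w * (xM - (xm - ym)) <= a + b + w * w.
  have := Ha _ _ MW; have := Hb _ _ mW; have := HW _ _ MW; have := HW _ _ mW.
  by nia.
have le2 : w * (a + b) <= a + b + w * w by nia.
have w3 : w <= 3 by nia.
have ww : w = 2.
  (* For [w = 3], [n1] and [n2] give [a + b >= 6], whereas [le2] gives [a + b <= 4]. *)
  have [//|w3'] : w = 2 \/ w = 3 by lia.
  by subst w; lia.
subst w; have n4 : a + b <= 4 by lia.
have [j0|j1] : j = 0 \/ j = 1 by lia.
  subst j.
  have [x [y [x' [y' [zW z'W le]]]]] := wide_shear 0 wW.
  have := Hb _ _ zW; have := Ha _ _ z'W => h1 h2.
  (* Since [x' - x >= 2] and [a + b <= 4], necessarily [2 * x = - b] and [2 * x' = a]: the strip is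
     exactly [x] to [x + 2]. *)
  apply: (@has_normal_form_box2 x) => //.
    move=> x1 y1 W1; have := Hb _ _ W1; have := Ha _ _ W1; have := HW _ _ W1; lia.
  exists (0, 2), (xb, yb), (xa, ya); split=> //.
  by rewrite ob oa; split; lia.
subst j; have [ba|ab] := leP b a.
  apply: (@has_normal_form_skew2 a b) => //.
  - by move=> x y W1; have := Hb _ _ W1; have := Ha _ _ W1; have := HW _ _ W1; lia.
  - by exists xa, ya; split; rewrite // /a; lia.
  - by exists xb, yb; split; rewrite // /b; lia.
(* This reflection fixes [(0, 0)] and [(1, 2)] and negates [2 * x - y], exchanging [a] and [b]. *)
have u : unimap (zaff (-1) 1 0 1 0 0) by apply: zaff_unimap; lia.
apply: (has_normal_form_map u); apply: (@has_normal_form_skew2 b a) => //.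
- exact: wide_map.
- lia.
- lia.
- by apply/mapP; exists (0, 0).
- by apply/mapP; exists (1, 2).
- move=> x y /mapP[[x1 y1] W1 [-> ->]] /=.
  have := Hb _ _ W1; have := Ha _ _ W1; have := HW _ _ W1; lia.
- exists (yb - xb), yb; split; last by rewrite /b; lia.
  by apply/mapP; exists (xb, yb) => //; rewrite /zaff /=; congr (_, _); lia.
- exists (ya - xa), ya; split; last by rewrite /a; lia.
  by apply/mapP; exists (xa, ya) => //; rewrite /zaff /=; congr (_, _); lia.
Qed.

(** A shear aligns the left ends of the two rows; a vertical flip puts the longer row at the
    bottom. *)
Lemma has_normal_form_width1 (W : seq (int * int)) :
  (forall x y : int, (x, y) \in W -> 0 <= y <= 1) ->
  (exists x, (x, 0) \in W) -> (exists x, (x, 1) \in W) -> has_normal_form W.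
Proof.
move=> HW [x0 W0] [x1 W1].
have row (t : int) xt : (xt, t) \in W -> exists l r, [/\ (l, t) \in W, (r, t) \in W &
    forall x, (x, t) \in W -> l <= x <= r].
  move=> Wt.
  have Wt' : (xt, t) \in [seq z <- W | z.2 == t] by rewrite mem_filter /= eqxx.
  have [[r r2]] := seq_argmax (fun z => z.1) Wt'.
  rewrite mem_filter /= => /andP[/eqP-> rW] hr.
  have [[l l2]] := seq_argmin (fun z => z.1) Wt'.
  rewrite mem_filter /= => /andP[/eqP-> lW] hl.
  exists l, r; split=> // x xW.
  have xF : (x, t) \in [seq z <- W | z.2 == t] by rewrite mem_filter /= eqxx.
  by have := hl _ xF; have := hr _ xF => /= -> ->.
have [l0 [r0 [l0W r0W h0]]] := row _ _ W0.
have [l1 [r1 [l1W r1W h1]]] := row _ _ W1.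
have [lr0 lr1] : l0 <= r0 /\ l1 <= r1 by have := h0 _ r0W; have := h1 _ r1W; lia.
have HW' (x y : int) : (x, y) \in W ->
    (y = 0 /\ l0 <= x <= r0) \/ (y = 1 /\ l1 <= x <= r1).
  move=> xyW; have [e|e] : y = 0 \/ y = 1 by have := HW _ _ xyW; lia.
    by subst y; left; split=> //; apply: h0.
  by subst y; right; split=> //; apply: h1.
have [le|lt] := leP (r1 - l1) (r0 - l0).
  have u : unimap (zaff 1 (l0 - l1) 0 1 (- l0) 0) by apply: zaff_unimap; lia.
  apply: (has_normal_form_map u).
  apply: (@has_normal_form_trapezoid (r0 - l0) (r1 - l1)); first lia.
  - by apply/mapP; exists (l0, 0) => //; rewrite /zaff /=; congr (_, _); lia.
  - by apply/mapP; exists (r0, 0) => //; rewrite /zaff /=; congr (_, _); lia.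
  - by apply/mapP; exists (l1, 1) => //; rewrite /zaff /=; congr (_, _); lia.
  - by apply/mapP; exists (r1, 1) => //; rewrite /zaff /=; congr (_, _); lia.
  - move=> x y /mapP[[x' y'] /HW' h [-> ->]] /=.
    by case: h => -[-> h]; [left|right]; split; lia.
have u : unimap (zaff 1 (l0 - l1) 0 (-1) (- l0) 1) by apply: zaff_unimap; lia.
apply: (has_normal_form_map u).
apply: (@has_normal_form_trapezoid (r1 - l1) (r0 - l0)); first lia.
- by apply/mapP; exists (l1, 1) => //; rewrite /zaff /=; congr (_, _); lia.
- by apply/mapP; exists (r1, 1) => //; rewrite /zaff /=; congr (_, _); lia.
- by apply/mapP; exists (l0, 0) => //; rewrite /zaff /=; congr (_, _); lia.
- by apply/mapP; exists (r0, 0) => //; rewrite /zaff /=; congr (_, _); lia.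
- move=> x y /mapP[[x' y'] /HW' h [-> ->]] /=.
  by case: h => -[-> h]; [right|left]; split; lia.
Qed.

Lemma has_normal_formP (V : seq (int * int)) : V != [::] -> has_normal_form V.
Proof.
case: V => // v0 V' _; set V := v0 :: V'.
have v0V : v0 \in V by rewrite mem_head.
pose band (w : nat) := `[< exists2 phi, unimap phi &
   forall z, z \in V -> 0 <= (phi z).2 <= (w : int) >].
have exband : exists w, band w.
  have [[xM yM] MW hM] := seq_argmax (fun z => z.2) v0V.
  have [[xm ym] mW hm] := seq_argmin (fun z => z.2) v0V.
  exists (absz (yM - ym)); apply/asboolP; exists (zaff 1 0 0 1 0 (- ym)).
    by apply: zaff_unimap; lia.
  by move=> [x y] zV; have := hM _ zV; have := hm _ zV; rewrite /=; lia.
case: (ex_minnP exband) => w /asboolP[phi uphi hphi] wmin.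
apply: (has_normal_form_map uphi); set W := map phi V.
have HW (x y : int) : (x, y) \in W -> 0 <= y <= w%:Z.
  by move=> /mapP[z zV e]; have := hphi _ zV; rewrite -e.
have wW : wide w W.
  move=> psi upsi.
  have z0W : phi v0 \in W by apply: map_f.
  have [z' z'W h'] := seq_argmax (fun z => (psi z).2) z0W.
  have [z zW h] := seq_argmin (fun z => (psi z).2) z0W.
  exists z, z'; split=> //.
  have zz' := h _ z'W; rewrite /= in zz'.
  (* Translated, the coordinate [psi] gives a band as wide as its variation, which minimality bounds
     below by [w]. *)
  have bd : band (absz ((psi z').2 - (psi z).2)).
    apply/asboolP; exists (zaff 1 0 0 1 0 (- (psi z).2) \o (psi \o phi)).
      by apply: unimap_comp; [apply: unimap_comp | apply: zaff_unimap; lia].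
    move=> t tV; have tW : phi t \in W by apply: map_f.
    by have := h _ tW; have := h' _ tW; rewrite /=; lia.
  by have := wmin _ bd; lia.
(* The identity also varies by at least [w], so [y] attains both 0 and [w]. *)
have [x0 [y0 [xw [yw [z0W zwW le]]]]] : exists x y x' y' : int,
    [/\ (x, y) \in W, (x', y') \in W & y + w <= y'].
  have [[x y] [[x' y'] []]] := wW _ unimap_id.
  by move=> ? ? ?; exists x, y, x', y'.
have [e0 ew] : y0 = 0 /\ yw = w.
  by have := HW _ _ z0W; have := HW _ _ zwW; lia.
subst y0 yw; case: (posnP w) => [w0|w0].
  by apply: has_normal_form_id; left=> x y /HW; lia.
have [w1|w2] : w = 1%N \/ (2 <= w)%N by lia.
  apply: has_normal_form_width1; first by move=> x y /HW; rewrite w1.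
    by exists x0.
  by exists xw; move: zwW; rewrite w1.
have wpos : 0 < w%:Z by lia.
(* Shearing by [k] reduces the horizontal offset of the two end points modulo [w]. *)
pose k := ((xw - x0) %/ w)%Z; pose j := ((xw - x0) %% w)%Z.
have kj : xw - x0 = k * w%:Z + j by apply: divz_eq.
have jw : 0 <= j < w%:Z by rewrite modz_ge0 ?ltz_pmod //; lia.
have u : unimap (zaff 1 (- k) 0 1 (- x0) 0) by apply: zaff_unimap; lia.
apply: (has_normal_form_map u); apply: (@has_normal_form_wide w%:Z j) => //.
- exact: wide_map.
- by apply/mapP; exists (x0, 0) => //; rewrite /zaff /=; congr (_, _); lia.
- by apply/mapP; exists (xw, w%:Z) => //; rewrite /zaff /=; congr (_, _); lia.
- by move=> x y /mapP[[x' y'] /HW h [_ ->]] /=; lia.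
Qed.

(** * Invariance of the area *)

Section Area.
Variable R : realType.
Local Notation mR := (measurableTypeR R).
Local Notation mR2 := (mR * mR)%type.
Implicit Types X Y N : set mR2.

Definition raff (a b c d e f : R) (p : mR2) : mR2 :=
  (a * p.1 + b * p.2 + e, c * p.1 + d * p.2 + f).

(** The integral is a supremum over simple functions and outer measure is monotone, so arbitrary
    sets can be compared; this bounds the area of a hull through triangles inside it. *)
Lemma area2_mono X Y : X `<=` Y -> (area2 X <= area2 Y)%E.
Proof.
move=> XY; rewrite /area2 /product_measure1.
rewrite !ge0_integralTE //; try by move=> x; exact: measure_ge0.
apply: le_ereal_sup => _ [h /= hX <-]; exists h => //= x.
apply: le_trans (hX x) _; apply: le_outer_measure => y.
by rewrite /xsection /= !inE; exact: XY.
Qed.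

Lemma measurable_lin (a b e : R) :
  measurable_fun [set: mR2] (fun p : mR2 => a * p.1 + b * p.2 + e : mR).
Proof.
by apply: measurable_funD => //; apply: measurable_funD; apply: measurable_funM.
Qed.

Lemma measurable_raff a b c d e f : measurable_fun [set: mR2] (raff a b c d e f).
Proof. by apply: measurable_fun_pair; exact: measurable_lin. Qed.

Lemma measurable_raff_preimage a b c d e f X :
  measurable X -> measurable (raff a b c d e f @^-1` X).
Proof. by move=> mX; rewrite -[_ @^-1` _]setTI; exact: measurable_raff. Qed.

Lemma measurable_halfplane (a b e : R) :
  measurable [set p : mR2 | 0 <= a * p.1 + b * p.2 + e].
Proof.
have := measurable_lin a b e measurableT (measurable_itv `[0%R, +oo[).
rewrite setTI; congr measurable; apply/seteqP; split=> p /=;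
  by rewrite in_itv /= andbT.
Qed.

(** The translated measure agrees with Lebesgue measure on half-open intervals, hence everywhere by
    uniqueness. *)
Lemma lebesgue_measure_shift (t : R) (A : set mR) : measurable A ->
  lebesgue_measure ((fun y : mR => y + t : mR) @^-1` A) = lebesgue_measure A.
Proof.
move=> mA.
have mf : measurable_fun [set: mR] (fun y : mR => y + t : mR).
  exact: measurable_funD.
pose f : {mfun mR >-> mR} := HB.pack (fun y : mR => y + t : mR)
  (isMeasurableFun.Build _ _ _ _ _ mf).
have H := @lebesgue_measure_unique R (pushforward (@lebesgue_measure R) f).
rewrite [RHS]H // => _ [[a b] _ <-] /=.
rewrite /pushforward /=.
have -> : f @^-1` `]a, b] = `]a - t, b - t]%classic.
  apply/seteqP; split=> y /=; rewrite !in_itv /= => /andP[h1 h2];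
    by apply/andP; split; lra.
rewrite !lebesgue_measure_itv /= !lte_fin.
have -> : (a - t < b - t) = (a < b) by rewrite ltrD2r.
by case: ifP => // _; congr EFin; lra.
Qed.

Lemma area2_shear (c f : R) X : measurable X ->
  area2 (raff 1 0 c 1 0 f @^-1` X) = area2 X.
Proof.
move=> mX; apply: eq_integral => x _ /=.
rewrite -(lebesgue_measure_shift (c * x + f) (measurable_xsection x mX)).
congr lebesgue_measure; apply/seteqP; split => y;
  rewrite /xsection /raff /= !inE /=; congr X; congr pair; lra.
Qed.

(** The image measure agrees with the product measure on rectangles, which determines it. *)
Lemma area2_swap X : measurable X -> area2 (raff 0 1 1 0 0 0 @^-1` X) = area2 X.
Proof.
move=> mX.
pose f : {mfun mR2 >-> mR2} := HB.pack (raff 0 1 1 0 0 0)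
  (isMeasurableFun.Build _ _ _ _ _ (measurable_raff 0 1 1 0 0 0)).
pose m := ((@lebesgue_measure R) \x (@lebesgue_measure R))%E.
have H := @product_measure_unique _ _ _ _ _ (@lebesgue_measure R) (@lebesgue_measure R)
  (pushforward m f).
rewrite /area2 [RHS]H // => A B mA mB.
have E : f @^-1` (A `*` B) = B `*` A.
  apply/seteqP; split => -[x y]; rewrite /f /raff /=;
   rewrite !(mul0r, mul1r, add0r, addr0); tauto.
rewrite -[LHS]/(m (f @^-1` (A `*` B))) E.
by rewrite /m product_measure1E // muleC.
Qed.

Lemma area2_line0 : area2 [set p : mR2 | p.2 = 0] = 0%E.
Proof.
have -> : [set p : mR2 | p.2 = 0] = setT `*` [set (0 : mR)].
  by apply/seteqP; split=> -[x y] /= => [->|[]].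
rewrite /area2 product_measure1E //.
by apply: etrans (mule0 _); congr mule; exact: lebesgue_measure_set1.
Qed.

Lemma area2_raff a b c d e f X : measurable X ->
  a * d - b * c = 1 \/ a * d - b * c = -1 ->
  area2 (raff a b c d e f @^-1` X) = area2 X.
Proof.
have comp a1 b1 c1 d1 e1 f1 a2 b2 c2 d2 e2 f2 Y :
    raff a2 b2 c2 d2 e2 f2 @^-1` (raff a1 b1 c1 d1 e1 f1 @^-1` Y) =
    raff (a1 * a2 + b1 * c2) (a1 * b2 + b1 * d2) (c1 * a2 + d1 * c2)
      (c1 * b2 + d1 * d2) (a1 * e2 + b1 * f2 + e1) (c1 * e2 + d1 * f2 + f1) @^-1` Y.
  by apply/seteqP; split=> p; rewrite /raff /=; congr Y; congr pair; ring.
have eqraff a1 b1 c1 d1 e1 f1 a2 b2 c2 d2 e2 f2 Y :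
    a1 = a2 -> b1 = b2 -> c1 = c2 -> d1 = d2 -> e1 = e2 -> f1 = f2 ->
    area2 (raff a1 b1 c1 d1 e1 f1 @^-1` Y) = area2 (raff a2 b2 c2 d2 e2 f2 @^-1` Y).
  by move=> -> -> -> -> -> ->.
(* A horizontal shear is a vertical one conjugated by the exchange of coordinates. *)
have hshear (b0 e0 : R) Y : measurable Y ->
    area2 (raff 1 b0 0 1 e0 0 @^-1` Y) = area2 Y.
  move=> mY.
  have mY1 := measurable_raff_preimage 0 1 1 0 0 0 mY.
  have mY2 := measurable_raff_preimage 1 0 b0 1 0 e0 mY1.
  rewrite -(area2_swap mY) -(area2_shear b0 e0 mY1) -(area2_swap mY2).
  by rewrite !comp; apply: eqraff; ring.
(* A matrix of determinant 1 with b <> 0 is a product of three shears. *)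
have det1_nz a0 b0 c0 d0 e0 f0 Y : measurable Y -> b0 != 0 ->
    a0 * d0 - b0 * c0 = 1 -> area2 (raff a0 b0 c0 d0 e0 f0 @^-1` Y) = area2 Y.
  move=> mY b00 det.
  pose k := (d0 - 1) / b0.
  rewrite -(area2_shear k (f0 - k * e0) mY).
  have mY1 := measurable_raff_preimage 1 0 k 1 0 (f0 - k * e0) mY.
  rewrite -(hshear b0 e0 _ mY1).
  rewrite -[RHS](area2_shear ((a0 - 1) / b0) 0); last exact: measurable_raff_preimage.
  have ec : c0 = (a0 * d0 - 1) / b0 by rewrite -det; field.
  by rewrite !comp; apply: eqraff; rewrite /k ?ec; field.
have det1 a0 b0 c0 d0 e0 f0 Y : measurable Y ->
    a0 * d0 - b0 * c0 = 1 -> area2 (raff a0 b0 c0 d0 e0 f0 @^-1` Y) = area2 Y.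
  (* If [b0 = 0], composing with a unit horizontal shear replaces it by [a0], which is nonzero. *)
  move=> mY det; have [b00|] := eqVneq b0 0; last by move=> ?; exact: det1_nz.
  have a00 : a0 != 0.
    by apply/eqP => a00; move: det; rewrite a00 b00; lra.
  rewrite -(hshear 1 0 (raff a0 b0 c0 d0 e0 f0 @^-1` Y)).
    rewrite comp; apply: det1_nz => //; rewrite b00; last by move: det; rewrite b00; lra.
    by rewrite mulr1 mul0r addr0.
  exact: measurable_raff_preimage.
move=> mX [|] det; first exact: det1.
rewrite -(area2_swap (measurable_raff_preimage a b c d e f mX)) comp.
by apply: det1 => //; lra.
Qed.

Lemma area2_almost_disjU X Y N : measurable X -> measurable Y -> measurable N ->
  area2 N = 0%E -> X `&` Y `<=` N -> (area2 (X `|` Y) = area2 X + area2 Y)%E.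
Proof.
pose m : {measure set mR2 -> \bar R} :=
  ((@lebesgue_measure R) \x (@lebesgue_measure R))%E.
rewrite -[@area2 R]/(m : set mR2 -> \bar R).
move=> mX mY mN N0 XYN.
have XY0 : m (Y `&` X) = 0%E.
  by apply: subset_measure0 N0 => //; [exact: measurableI | rewrite setIC].
have -> : m Y = m (Y `\` X).
  by rewrite (measureDI m mY mX) -[RHS]adde0; congr adde; exact: XY0.
rewrite -measureU //; last 2 first.
- exact: measurableD.
- by apply/seteqP; split=> // p [Xp [_ /(_ Xp)]].
congr (m _); apply/seteqP; split=> p; last by case=> [|[]]; [left|right].
by have [Xp _|nXp [//|Yp]] := pselect (X p); [left|right].
Qed.
End Area.

(** * Areas of triangles and quadrilaterals *)

Section Triangles.
Variable R : realType.
Local Notation mR := (measurableTypeR R).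
Local Notation mR2 := (mR * mR)%type.
Implicit Types X Y N : set mR2.

Definition right_triangle (d : R) : set mR2 :=
  [set p | 0 <= p.1 /\ 0 <= p.2 /\ d * p.1 + p.2 <= d].

Lemma area2_ge0 X : (0 <= area2 X)%E.
Proof. by apply: integral_ge0 => x _; exact: measure_ge0. Qed.

Lemma area2_rect (a b : R) : 0 <= a -> 0 <= b ->
  area2 (`[0, a] `*` `[0, b] : set mR2) = (a * b)%:E.
Proof.
move=> a0 b0; rewrite /area2 product_measure1E //; try exact: measurable_itv.
rewrite EFinM; congr mule; apply: etrans (lebesgue_measure_itv _) _;
  rewrite /= lte_fin oppr0 adde0 -?EFinD ?subr0.
  by case: ltgtP a0 => // <-.
by case: ltgtP b0 => // <-.
Qed.

Lemma measurable_line0 : measurable [set p : mR2 | p.2 = 0].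
Proof.
have -> : [set p : mR2 | p.2 = 0] = setT `*` [set (0 : mR)].
  by apply/seteqP; split=> -[x y] /= => [->|[]].
by apply: measurableX.
Qed.

Lemma measurable_right_triangle d : measurable (right_triangle d).
Proof.
have -> : right_triangle d = [set p : mR2 | 0 <= 1 * p.1 + 0 * p.2 + 0] `&`
   [set p : mR2 | 0 <= 0 * p.1 + 1 * p.2 + 0] `&`
   [set p : mR2 | 0 <= - d * p.1 + (-1) * p.2 + d].
  apply/seteqP; split=> p /=; rewrite /right_triangle /=.
    by move=> [? [? ?]]; split; [split|]; lra.
  by move=> [[? ?] ?]; do 2?split; lra.
by apply: measurableI; [apply: measurableI|]; exact: measurable_halfplane.
Qed.

(* The half-turn about the centre of [0,1] x [0,d] maps the triangle to the
   other half of the rectangle. *)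
Lemma area2_right_triangle d : 0 < d -> area2 (right_triangle d) = (d / 2)%:E.
Proof.
move=> d0; have mT := measurable_right_triangle d.
set T := right_triangle d in mT *.
pose T' := raff (-1) 0 0 (-1) 1 d @^-1` T.
(* [N] is the line through the hypotenuse, the only place where the two halves meet. *)
pose N := raff 1 0 d 1 0 (- d) @^-1` [set p : mR2 | p.2 = 0].
have mT' : measurable T' by exact: measurable_raff_preimage.
have mN : measurable N by apply: measurable_raff_preimage; exact: measurable_line0.
have N0 : area2 N = 0%E.
  rewrite area2_raff ?area2_line0 //; first exact: measurable_line0.
  by left; ring.
have TT' : area2 T' = area2 T by rewrite area2_raff //; left; ring.
have sub : T `&` T' `<=` N.
  by move=> p [[h1 [h2 h3]] [/= h4 [h5 h6]]]; rewrite /N /raff /=; lra.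
have cover : T `|` T' = `[0, 1] `*` `[0, d].
  apply/seteqP; split=> p.
    rewrite /T' /T /right_triangle /raff /= !in_itv /=.
    move=> [[h1 [h2 h3]]|[h1 [h2 h3]]]; split; apply/andP; split; nra.
  rewrite /= !in_itv /= => -[/andP[h1 h2] /andP[h3 h4]].
  have [h|h] := leP (d * p.1 + p.2) d.
    by left; split => //; split.
  by right; split; [|split]; rewrite /raff /=; lra.
have := area2_almost_disjU mT mT' mN N0 sub.
rewrite cover TT' area2_rect ?ltW // mul1r.
by case: (area2 T) => [t||] //= [->]; congr EFin; field.
Qed.

Definition orientR (p q r : mR2) : R :=
  (q.1 - p.1) * (r.2 - p.2) - (q.2 - p.2) * (r.1 - p.1).

Lemma hull3P (p q r x : R * R) : hull [:: p; q; r] x <->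
  exists al be, [/\ 0 <= al, 0 <= be, al + be <= 1 &
    x = (p.1 + al * (q.1 - p.1) + be * (r.1 - p.1),
         p.2 + al * (q.2 - p.2) + be * (r.2 - p.2))].
Proof.
split.
  move=> [w [w0 [w1 ->]]].
  move: w1; rewrite !big_ord_recl !big_ord0 /= => w1.
  set w0' := w ord0 in w1 *.
  set w1' := w (lift ord0 ord0) in w1 *.
  set w2' := w (lift ord0 (lift ord0 ord0)) in w1 *.
  exists w1', w2'; split; try exact: w0.
    by have := w0 ord0; rewrite -/w0'; lra.
  have -> : w0' = 1 - w1' - w2' by lra.
  by congr pair; ring.
move=> [al [be [a0 b0 ab ->]]].
exists (fun i => nth 0 [:: 1 - al - be; al; be] i); split.
  by case=> [[|[|[|//]]]] /= _; lra.
rewrite !big_ord_recl !big_ord0 /=; split; first by ring.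
by congr pair; ring.
Qed.

(** The map sends a point with barycentric weights [al], [be] at [q], [r] to [(al, s * D * be)].
    Putting the whole area into one leg keeps its determinant equal to [s], so [area2_raff] applies
    without any scaling law. *)
Lemma hull3_preimage (s : R) (p q r : mR2) : s = 1 \/ s = -1 ->
  0 < s * orientR p q r -> let D := orientR p q r in
  hull [:: p; q; r] =
  raff ((r.2 - p.2) / D) (- (r.1 - p.1) / D)
    (- s * (q.2 - p.2)) (s * (q.1 - p.1))
    (- (p.1 * (r.2 - p.2) - p.2 * (r.1 - p.1)) / D)
    (s * (p.1 * (q.2 - p.2) - p.2 * (q.1 - p.1))) @^-1` right_triangle (s * D).
Proof.
move=> hs sD; set D := orientR p q r in sD *; move=> /=.
have D0 : D != 0 by apply: contraTneq sD => ->; rewrite mulr0 ltxx.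
have s0 : s != 0 by case: hs => ->; lra.
have sE : s * s = 1 by case: hs => ->; ring.
apply/seteqP; split=> x.
  move=> /hull3P[al [be [a0 b0 ab ->]]].
  rewrite /raff /right_triangle /=.
  have -> : (r.2 - p.2) / D * (p.1 + al * (q.1 - p.1) + be * (r.1 - p.1)) +
    - (r.1 - p.1) / D * (p.2 + al * (q.2 - p.2) + be * (r.2 - p.2)) +
    - (p.1 * (r.2 - p.2) - p.2 * (r.1 - p.1)) / D = al.
    by rewrite /D /orientR; field; exact: D0.
  have -> : - s * (q.2 - p.2) * (p.1 + al * (q.1 - p.1) + be * (r.1 - p.1)) +
    s * (q.1 - p.1) * (p.2 + al * (q.2 - p.2) + be * (r.2 - p.2)) +
    s * (p.1 * (q.2 - p.2) - p.2 * (q.1 - p.1)) = s * D * be.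
    by rewrite /D /orientR; ring.
  split=> //; split; first by rewrite mulr_ge0 // ltW.
  by rewrite -mulrDr -[leRHS]mulr1 ler_pM2l.
rewrite /raff /right_triangle /=.
set al := _ + _; set ga := _ + _ => -[a0 [g0 h]].
apply/hull3P; exists al, (ga / (s * D)); split => //.
- by rewrite divr_ge0 // ltW.
- rewrite -(ler_pM2l sD) mulrDr mulr1 [X in _ + X]mulrC mulfVK //.
  by rewrite mulf_neq0.
- rewrite [x in LHS]surjective_pairing; congr pair;
  by rewrite /al /ga /D /orientR; field; rewrite s0 andbT; exact: D0.
Qed.

Lemma sign_mulr_norm (D : R) : D != 0 -> exists2 s : R, s = 1 \/ s = -1 & s * D = `|D|.
Proof.
move=> D0; exists (Num.sg D); last by rewrite -normrEsg.
by case: sgrP D0 => // *; [left|right].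
Qed.

Lemma hull3_area (p q r : mR2) : orientR p q r != 0 ->
  measurable (hull [:: p; q; r] : set mR2) /\
  area2 (hull [:: p; q; r]) = (`|orientR p q r| / 2)%:E.
Proof.
move=> D0; have [s hs sD] := sign_mulr_norm D0.
have sD0 : 0 < s * orientR p q r by rewrite sD normr_gt0.
rewrite (hull3_preimage hs sD0).
have mT := measurable_right_triangle (s * orientR p q r).
split; first exact: measurable_raff_preimage.
rewrite area2_raff // ?area2_right_triangle ?sD //; first by rewrite -sD.
have det : forall t : R, t = (r.2 - p.2) / orientR p q r * (s * (q.1 - p.1)) -
   - (r.1 - p.1) / orientR p q r * (- s * (q.2 - p.2)) -> t = s.
  by move=> t ->; rewrite /orientR; field; exact: D0.
by rewrite (det _ erefl).
Qed.

(** A map of determinant 1 carries the line [pq] to the horizontal axis; the point [r] off the line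
    supplies its first coordinate. *)
Lemma area2_line (p q r : mR2) : orientR p q r != 0 ->
  measurable [set x : mR2 | orientR p q x = 0] /\
  area2 [set x : mR2 | orientR p q x = 0] = 0%E.
Proof.
move=> D0.
pose M := raff ((r.2 - p.2) / orientR p q r) (- (r.1 - p.1) / orientR p q r)
    (- (q.2 - p.2)) (q.1 - p.1) 0 (p.1 * (q.2 - p.2) - p.2 * (q.1 - p.1)).
have -> : [set x : mR2 | orientR p q x = 0] = M @^-1` [set p : mR2 | p.2 = 0].
  apply/seteqP; split=> x; rewrite /M /raff /orientR /= => h;
    by rewrite -[RHS]h; ring.
have mL := measurable_line0; split; first exact: measurable_raff_preimage.
rewrite area2_raff ?area2_line0 //; left.
by rewrite /orientR; field; exact: D0.
Qed.

Lemma hull3_side (s : R) (p q r x : mR2) : 0 <= s * orientR p q r ->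
  hull [:: p; q; r] x -> 0 <= s * orientR p q x.
Proof.
move=> sD /hull3P[al [be [a0 b0 ab ->]]].
have -> : s * orientR p q (p.1 + al * (q.1 - p.1) + be * (r.1 - p.1),
         p.2 + al * (q.2 - p.2) + be * (r.2 - p.2)) = be * (s * orientR p q r).
  by rewrite /orientR /=; ring.
exact: mulr_ge0.
Qed.

Lemma area2_quad (p q r s : mR2) : 0 <= orientR p q r -> orientR p q s <= 0 ->
  (((orientR p q r - orientR p q s) / 2)%:E <=
     area2 (hull [:: p; q; r] `|` hull [:: p; q; s]))%E.
Proof.
move=> hr hs.
(* A degenerate triangle contributes nothing, and monotonicity keeps the other one. *)
have [r0|r0] := eqVneq (orientR p q r) 0; have [s0|s0] := eqVneq (orientR p q s) 0.
- by rewrite r0 s0 subr0 mul0r; exact: area2_ge0.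
- have [_ as_] := hull3_area s0.
  apply: (le_trans _ (area2_mono (@subsetUr _ _ _))).
  by rewrite as_ r0 sub0r ler0_norm.
- have [_ ar] := hull3_area r0.
  apply: (le_trans _ (area2_mono (@subsetUl _ _ _))).
  by rewrite ar s0 subr0 ger0_norm.
have [mr ar] := hull3_area r0; have [ms as_] := hull3_area s0.
have [mN N0] := area2_line r0.
rewrite (area2_almost_disjU mr ms mN N0).
  by rewrite ar as_ -EFinD lee_fin ger0_norm // ler0_norm //; lra.
move=> x [hx1 hx2] /=.
have h1 : 0 <= 1 * orientR p q x by apply: hull3_side hx1; rewrite mul1r.
have h2 : 0 <= -1 * orientR p q x by apply: hull3_side hx2; lra.
lra.
Qed.
End Triangles.

(** * Convex hulls and lattice maps *)

Section Hull.
Variable R : realType.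
Implicit Types V W : seq (R * R).

Lemma mem_hull W z : z \in W -> hull W z.
Proof.
move=> zW; have hi : (index z W < size W)%N by rewrite index_mem.
exists (fun i => (i == Ordinal hi)%:R); split; first by move=> i; exact: ler0n.
have pick (F : 'I_(size W) -> R) : \sum_i (i == Ordinal hi)%:R * F i = F (Ordinal hi).
  rewrite (bigD1 (Ordinal hi)) //= eqxx mul1r big1 ?addr0 // => i /negPf ->.
  by rewrite mul0r.
split; last by rewrite !pick /= nth_index //; case: z {zW hi pick}.
by have := pick (fun=> 1); under eq_bigr do rewrite mulr1.
Qed.

Lemma hull_raff a b c d e f V W :
  (forall z, z \in W -> hull V (raff a b c d e f z)) ->
  hull W `<=` raff a b c d e f @^-1` hull V.
Proof.
move=> WV x [w [w0 [w1 xE]]].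
have /choice[u hu] (i : 'I_(size W)) := WV _ (mem_nth (0, 0) (ltn_ord i)).
(* [u i] are the weights of the image of the [i]-th point; averaging them with [w] gives weights for
   the image of [x]. *)
exists (fun j => \sum_i w i * u i j); split.
  by move=> j; apply: sumr_ge0 => i _; rewrite mulr_ge0 //; have [] := hu i.
have swapE (F : 'I_(size V) -> R) :
    \sum_j (\sum_i w i * u i j) * F j = \sum_i w i * (\sum_j u i j * F j).
  under eq_bigr do rewrite mulr_suml.
  rewrite exchange_big /=; apply: eq_bigr => i _.
  by rewrite mulr_sumr; apply: eq_bigr => j _; rewrite mulrA.
split.
  have := swapE (fun=> 1); under eq_bigr do rewrite mulr1.
  move=> ->; rewrite -[RHS]w1; apply: eq_bigr => i _.
  under eq_bigr do rewrite mulr1.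
  by have [_ [-> _]] := hu i; rewrite mulr1.
rewrite !swapE xE.
have lin (g1 g2 g3 : R) : \sum_(i < size W) w i * (g1 * (nth (0, 0) W i).1 +
     g2 * (nth (0, 0) W i).2 + g3) =
   g1 * (\sum_(i < size W) w i * (nth (0, 0) W i).1) +
   g2 * (\sum_(i < size W) w i * (nth (0, 0) W i).2) + g3.
  rewrite -[X in _ + X]mul1r -w1 mulr_suml !mulr_sumr -!big_split /=.
  by apply: eq_bigr => i _; ring.
rewrite /raff /=; congr pair; rewrite -lin; apply: eq_bigr => i _;
  by have [_ [_ [E1 E2]]] := hu i; rewrite ?E1 ?E2.
Qed.

Lemma raff_id (x : R * R) : raff 1 0 0 1 0 0 x = x.
Proof. by case: x => x y; rewrite /raff /=; congr pair; ring. Qed.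

Lemma hull_sub V W : (forall z, z \in W -> hull V z) -> hull W `<=` hull V.
Proof.
move=> WV x hx; rewrite -[x]raff_id.
by apply: hull_raff hx => z; rewrite raff_id; exact: WV.
Qed.

Lemma hull_halfplane a b e W : (forall z, z \in W -> 0 <= a * z.1 + b * z.2 + e) ->
  forall x, hull W x -> 0 <= a * x.1 + b * x.2 + e.
Proof.
move=> hW x [w [w0 [w1 ->]]] /=.
rewrite -[X in _ + X]mul1r -w1 mulr_suml !mulr_sumr -!big_split /=.
apply: sumr_ge0 => i _.
have -> : a * (w i * (W`_i).1) + b * (w i * (W`_i).2) + w i * e =
   w i * (a * (W`_i).1 + b * (W`_i).2 + e) by ring.
by rewrite mulr_ge0 //; apply: hW; exact: mem_nth.
Qed.

(** The adjugate formula for the inverse, with [s] in place of [1 / s] since [s] will be 1 or -1. *)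
Definition raff_inv (a b c d e f s : R) :=
  raff (s * d) (- (s * b)) (- (s * c)) (s * a)
    (- (s * (d * e - b * f))) (- (s * (a * f - c * e))).

Lemma raff_invK a b c d e f s : a * d - b * c = s -> s * s = 1 ->
  cancel (raff a b c d e f) (raff_inv a b c d e f s) /\
  cancel (raff_inv a b c d e f s) (raff a b c d e f).
Proof.
move=> ds ss; split=> -[x y]; rewrite /raff_inv /raff /=; congr pair.
- transitivity (s * (a * d - b * c) * x); first by ring.
  by rewrite ds ss mul1r.
- transitivity (s * (a * d - b * c) * y); first by ring.
  by rewrite ds ss mul1r.
- transitivity (s * (a * d - b * c) * x - (s * (a * d - b * c) - 1) * e); first by ring.
  by rewrite ds ss; ring.
- transitivity (s * (a * d - b * c) * y - (s * (a * d - b * c) - 1) * f); first by ring.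
  by rewrite ds ss; ring.
Qed.

Local Notation iR x := (x%:~R : R).

Lemma aff_raff (A : 'M[int]_2) v (p : R * R) : aff A v p =
  raff (iR (A 0 0)) (iR (A 0 1)) (iR (A 1 0)) (iR (A 1 1)) (iR v.1) (iR v.2) p.
Proof. by []. Qed.

Lemma det2 (A : 'M[int]_2) : \det A = A 0 0 * A 1 1 - A 0 1 * A 1 0.
Proof.
rewrite (expand_det_row _ 0) !big_ord_recl big_ord0 /cofactor !det_mx11 !mxE /=.
rewrite addr0 expr0 expr1 mul1r mulN1r mulrN.
by congr (_ * A _ _ - A _ _ * A _ _); apply/val_inj.
Qed.

Lemma unimodular_det (A : 'M[int]_2) : unimodular A -> exists2 s : R,
  s = 1 \/ s = -1 & iR (A 0 0) * iR (A 1 1) - iR (A 0 1) * iR (A 1 0) = s.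
Proof.
rewrite /unimodular det2 => h; exists (iR (A 0 0 * A 1 1 - A 0 1 * A 1 0)).
  by case: h => ->; [left | right; rewrite rmorphN1].
by rewrite rmorphB !rmorphM.
Qed.

(** Passes from images, used in [lattice_equiv], to preimages, used in the area lemmas. *)
Lemma aff_preimage_image (A : 'M[int]_2) v (P Q : set (R * R)) : unimodular A ->
  aff A v @` P = Q <-> P = aff A v @^-1` Q.
Proof.
move=> /unimodular_det[s s1 ds].
have ss : s * s = 1 by case: s1 => ->; ring.
have [K1 K2] := raff_invK (iR v.1) (iR v.2) ds ss.
split=> [<-|->].
  apply/seteqP; split=> x; first by move=> Px; exists x.
  by move=> [y Py]; rewrite !aff_raff => /(can_inj K1) <-.
apply/seteqP; split=> x; first by case=> y Qy <-.
by move=> Qx; exists (raff_inv (iR (A 0 0)) (iR (A 0 1)) (iR (A 1 0)) (iR (A 1 1))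
  (iR v.1) (iR v.2) s x); rewrite ?aff_raff /= ?aff_raff K2.
Qed.

Lemma area2_aff (A : 'M[int]_2) v (Q : set (measurableTypeR R * measurableTypeR R)) :
  unimodular A -> measurable Q -> area2 (aff A v @^-1` Q) = area2 Q.
Proof.
move=> /unimodular_det[s s1 ds] mQ.
by apply: (@area2_raff R _ _ _ _ (iR v.1) (iR v.2)) => //; rewrite ds.
Qed.

Lemma area2_equiv (P : set (R * R)) (Q : set (measurableTypeR R * measurableTypeR R)) :
  lattice_equiv P Q -> measurable Q -> area2 P = area2 Q.
Proof.
by move=> [A [v [uA /(aff_preimage_image _ _ _ uA) ->]]] mQ; exact: area2_aff.
Qed.

Local Notation zpt := (@zpt R).

Lemma hull_unimap phi (V : seq (int * int)) : unimap phi -> exists A v,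
  unimodular A /\ aff A v @` hull (map zpt V) = hull (map zpt (map phi V)).
Proof.
move=> [a [b [c [d [e [f [h phiE]]]]]]].
pose A : 'M[int]_2 := \matrix_(i, j)
  if i == 0 then (if j == 0 then a else b) else (if j == 0 then c else d).
have uA : unimodular A by rewrite /unimodular det2 !mxE.
exists A, (e, f); split => //; apply/(aff_preimage_image _ _ _ uA).
have affE z : aff A (e, f) (zpt z) = zpt (phi z).
  rewrite phiE /aff /zpt /zaff !mxE /=.
  by congr pair; rewrite !rmorphD !rmorphM.
apply/seteqP; split=> x.
  apply: hull_raff => _ /mapP[z zV ->]; rewrite -aff_raff affE.
  by apply: mem_hull; do 2!apply: map_f.
move=> hx; have [s s1 ds] := unimodular_det uA.
have ss : s * s = 1 by case: s1 => ->; ring.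
have [K1 K2] := raff_invK (iR e) (iR f) ds ss.
rewrite -[x]K1; apply: hull_raff hx => _ /mapP[_ /mapP[z zV ->] ->].
by rewrite -affE [X in hull _ X](K1 (zpt z)); apply: mem_hull; apply: map_f.
Qed.

Lemma orientR_zpt p q r : orientR (zpt p) (zpt q) (zpt r) = iR (orient p q r).
Proof. by rewrite /orientR /orient /= !(rmorphB, rmorphM). Qed.

Lemma area2_hull_quad (V : seq (int * int)) p q r s :
  p \in V -> q \in V -> r \in V -> s \in V ->
  0 <= orient p q r -> orient p q s <= 0 ->
  ((iR (orient p q r - orient p q s) / 2)%:E <= area2 (hull (map zpt V)))%E.
Proof.
move=> pV qV rV sV hr hs.
have := @area2_quad R (zpt p) (zpt q) (zpt r) (zpt s).
rewrite !orientR_zpt ler0z lerz0 -rmorphB => /(_ hr hs) /le_trans; apply.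
have sub t : t \in V -> hull [:: zpt p; zpt q; zpt t] `<=` hull (map zpt V).
  move=> tV; apply: hull_sub => z; rewrite !inE => /or3P[] /eqP ->;
    by apply: mem_hull; apply: map_f.
by apply: area2_mono => x [/(sub _ rV)|/(sub _ sV)].
Qed.

Lemma ls_Delta_le (P : set (R * R)) A v L : 0 <= L -> unimodular A ->
  aff A v @` P `<=` scaled_Delta L -> ls_Delta P <= L.
Proof.
move=> L0 uA PL; apply: ge_inf; first by exists 0 => l [].
by split=> //; exists A, v.
Qed.
End Hull.

(** * The extremal polygons *)

Section Models.
Variable R : realType.
Local Notation zpt := (@zpt R).
Local Notation iR x := (x%:~R : R).

Definition unit_square : set (R * R) := [set p | 0 <= p.1 <= 1 /\ 0 <= p.2 <= 1].

Lemma measurable_unit_square :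
  measurable (unit_square : set (measurableTypeR R * measurableTypeR R)).
Proof.
have -> : unit_square = `[0, 1] `*` `[0, 1] by [].
by apply: measurableX; exact: measurable_itv.
Qed.

Lemma area2_unit_square : area2 unit_square = 1%:E.
Proof. by rewrite -[1%R](mulr1 1); apply: area2_rect; exact: ler01. Qed.

Lemma area2_model (P : set (R * R)) (l : R) :
  (1 <= l /\ lattice_equiv P (hull [:: pt 0 0; pt l 0; pt 0 1])) \/
  (l = 2 /\ lattice_equiv P unit_square) \/
  (l = 3 /\ lattice_equiv P (hull [:: pt 0 0; pt 1 2; pt 2 1])) ->
  area2 P = (l / 2)%:E.
Proof.
case=> [[l1 e]|[[-> e]|[-> e]]].
- have o : orientR (pt 0 0) (pt l 0) (pt 0 1) = l by rewrite /orientR /pt /=; ring.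
  have l0 : 0 < l by lra.
  have [] := @hull3_area R (pt 0 0) (pt l 0) (pt 0 1); first by rewrite o gt_eqF.
  by move=> m; rewrite (area2_equiv e m) o gtr0_norm.
- rewrite (area2_equiv e measurable_unit_square) area2_unit_square.
  by congr EFin; lra.
- have o : orientR (pt 0 0) (pt 1 2) (pt 2 1) = (-3 : R).
    by rewrite /orientR /pt /=; ring.
  have [] := @hull3_area R (pt 0 0) (pt 1 2) (pt 2 1).
    by rewrite o; apply/eqP; lra.
  by move=> m; rewrite (area2_equiv e m) o normrN ger0_norm.
Qed.

Lemma hull_scaled_Delta (W : seq (int * int)) L :
  (forall z, z \in W -> in_zDelta L z) -> hull (map zpt W) `<=` scaled_Delta (iR L).
Proof.
move=> WL x hx; rewrite /scaled_Delta /=.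
have h a b e (H : forall z, in_zDelta L z -> 0 <= a * iR z.1 + b * iR z.2 + e) :
    0 <= a * x.1 + b * x.2 + e.
  by apply: hull_halfplane hx => _ /mapP[z zW ->]; apply: H; exact: WL.
have h1 : 0 <= 1 * x.1 + 0 * x.2 + 0.
  by apply: h => z [? [? ?]]; rewrite mul0r !addr0 mul1r ler0z.
have h2 : 0 <= 0 * x.1 + 1 * x.2 + 0.
  by apply: h => z [? [? ?]]; rewrite mul0r addr0 add0r mul1r ler0z.
have h3 : 0 <= -1 * x.1 + -1 * x.2 + iR L.
  apply: h => z [? [? ?]].
  have -> : -1 * iR z.1 + -1 * iR z.2 + iR L = iR (L - (z.1 + z.2)).
    by rewrite rmorphB rmorphD /=; ring.
  by rewrite ler0z subr_ge0.
by do 2?split; lra.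
Qed.

Lemma hull_thin (k : int) W : 1 <= k ->
  (0, 0) \in W -> (k, 0) \in W -> (0, 1) \in W ->
  (forall x y : int, (x, y) \in W -> 0 <= x /\ 0 <= y /\ x + k * y <= k) ->
  hull (map zpt W) = hull [:: pt 0 0; pt (iR k) 0; pt 0 1].
Proof.
move=> k1 W00 Wk W01 HW; apply/seteqP; split; apply: hull_sub; last first.
  move=> z; rewrite !inE => /or3P[] /eqP ->; apply: mem_hull; apply/mapP.
  - by exists (0, 0).
  - by exists (k, 0).
  - by exists (0, 1).
move=> _ /mapP[[x y] /HW[x0 [y0 h]] ->].
have k0 : 0 < iR k by rewrite ltr0z; lia.
apply/hull3P; exists (iR x / iR k), (iR y); split.
- by rewrite divr_ge0 ?ler0z //; lia.
- by rewrite ler0z.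
- rewrite -(ler_pM2l k0) mulrDr mulrC divfK ?gt_eqF // mulr1.
  by rewrite -rmorphM -rmorphD ler_int.
- rewrite /zpt /pt /=; congr pair; last by ring.
  by rewrite !subr0 mulr0 addr0 add0r divfK ?gt_eqF.
Qed.

Lemma hull_square W : square W -> hull (map zpt W) = unit_square.
Proof.
move=> [W00 W10 W01 W11 HW]; apply/seteqP; split=> x.
  move=> hx; have h a b e (H : forall u v : int, 0 <= u <= 1 /\ 0 <= v <= 1 ->
     0 <= a * iR u + b * iR v + e) : 0 <= a * x.1 + b * x.2 + e.
    apply: hull_halfplane hx => _ /mapP[[u v] /HW uv ->]; exact: H.
  have cast (u : int) : 0 <= u <= 1 -> 0 <= iR u <= 1.
    by move=> u01; rewrite ler0z lerz1.
  have h1 : 0 <= 1 * x.1 + 0 * x.2 + 0 by apply: h => u v [/cast ? /cast ?]; lra.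
  have h2 : 0 <= 0 * x.1 + 1 * x.2 + 0 by apply: h => u v [/cast ? /cast ?]; lra.
  have h3 : 0 <= -1 * x.1 + 0 * x.2 + 1 by apply: h => u v [/cast ? /cast ?]; lra.
  have h4 : 0 <= 0 * x.1 + -1 * x.2 + 1 by apply: h => u v [/cast ? /cast ?]; lra.
  by split; apply/andP; split; lra.
move=> [/andP[x0 x1] /andP[y0 y1]].
have sub p q r : p \in W -> q \in W -> r \in W ->
    hull [:: zpt p; zpt q; zpt r] `<=` hull (map zpt W).
  move=> pW qW rW; apply: hull_sub => z; rewrite !inE => /or3P[] /eqP ->;
    by apply: mem_hull; apply: map_f.
(* The diagonal [x + y = 1] cuts the square into two triangles. *)
have [le|lt] := leP (x.1 + x.2) 1.
  apply: (sub _ _ _ W00 W10 W01); apply/hull3P; exists x.1, x.2; split => //.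
  by rewrite [LHS]surjective_pairing /zpt /=; congr pair; ring.
apply: (sub _ _ _ W11 W01 W10); apply/hull3P; exists (1 - x.1), (1 - x.2).
split; [lra|lra|lra|].
by rewrite [LHS]surjective_pairing /zpt /=; congr pair; ring.
Qed.

Lemma hull_central W : central W ->
  hull (map zpt W) = hull [:: pt 0 0; pt 1 2; pt 2 1].
Proof.
move=> [W00 W12 W21 HW]; apply/seteqP; split; apply: hull_sub; last first.
  move=> z; rewrite !inE => /or3P[] /eqP ->; apply: mem_hull; apply/mapP.
  - by exists (0, 0).
  - by exists (1, 2).
  - by exists (2, 1).
move=> _ /mapP[z /HW + ->]; rewrite !inE => /or4P[] /eqP ->.
- by apply: mem_hull; rewrite !inE eqxx.
(* [(1, 1)] is the centroid. *)
- apply/hull3P; exists 3%:R^-1, 3%:R^-1; split; [lra|lra|lra|].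
  by rewrite /zpt /pt /=; congr pair; field.
- by apply: mem_hull; rewrite !inE eqxx ?orbT.
- by apply: mem_hull; rewrite !inE eqxx ?orbT.
Qed.
End Models.

(** * The area inequality and its equality cases *)

Unset Implicit Arguments.

Theorem mainTheorem4 (R : realType) (P : set (R * R)) :
  lattice_polygon P -> area2 P != 0%E ->
  let l := ls_Delta P in
  ((l / 2)%:E <= area2 P)%E /\
  (area2 P = (l / 2)%:E <->
     (1 <= l /\ lattice_equiv P (hull [:: pt 0 0; pt l 0; pt 0 1]))
  \/ (l = 2 /\ lattice_equiv P [set p | 0 <= p.1 <= 1 /\ 0 <= p.2 <= 1])
  \/ (l = 3 /\ lattice_equiv P (hull [:: pt 0 0; pt 1 2; pt 2 1]))).
Proof.
move=> [V [V0 PV]] aP l.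
have [phi uphi nW] := has_normal_formP V0.
have [A [v [uA imP]]] := hull_unimap R V uphi.
rewrite -PV in imP; set W := map phi V in nW imP.
have lsle (L : int) : (forall z, z \in W -> in_zDelta L z) -> 0 <= L -> l <= L%:~R.
  move=> WL L0; apply: (@ls_Delta_le R P A v _ _ uA); first by rewrite ler0z.
  by rewrite imP; exact: hull_scaled_Delta.
set model := (X in _ <-> X).
have modelE : model -> area2 P = (l / 2)%:E by exact: area2_model.
have strict : ((l / 2)%:E < area2 P)%E -> ((l / 2)%:E <= area2 P)%E /\
    (area2 P = (l / 2)%:E <-> model).
  move=> lt; split; first exact: ltW.
  by split=> [e|/modelE//]; rewrite e ltxx in lt.
(* Only the upper bound [l <= k] is proved for a model of parameter [k]: if [area2 P] equals both
   [k / 2] and [l / 2], then [l = k]. *)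
have tight (k : R) : (l = k -> model) -> area2 P = (k / 2)%:E -> l <= k ->
    ((l / 2)%:E <= area2 P)%E /\ (area2 P = (l / 2)%:E <-> model).
  move=> km aE lk; split; first by rewrite aE lee_fin; lra.
  by split=> // ; rewrite aE => -[e]; apply: km; lra.
case: nW => [fW|[tW|[[k k1 [W0 Wk W1 HW]]|[sqW|cW]]]].
(* In the flat case [P] lies in the preimage of the horizontal axis, a null set. *)
- case/eqP: aP; apply/eqP; rewrite eq_le area2_ge0 andbT.
  have eP := (aff_preimage_image _ _ _ uA).1 imP.
  rewrite -(area2_line0 R) -(area2_aff v uA (@measurable_line0 R)) eP.
  apply: area2_mono => x /= hx.
  have g1 : 0 <= 0 * (aff A v x).1 + 1 * (aff A v x).2 + 0.
    apply: hull_halfplane hx => _ /mapP[[a b] /fW -> ->] /=; lra.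
  have g2 : 0 <= 0 * (aff A v x).1 + -1 * (aff A v x).2 + 0.
    apply: hull_halfplane hx => _ /mapP[[a b] /fW -> ->] /=; lra.
  by move: g1 g2; rewrite /aff /=; lra.
- have [L [p [q [r [s [pW [qW [rW [sW [WL [h1 [h2 h3]]]]]]]]]]]] := tW.
  apply: strict; have lL : l <= L%:~R.
    by apply: lsle => //; have [? [? ?]] := WL _ pW; lia.
  (* The quadrilateral is pulled back to the original vertices [V], so its area bounds that of [P]
     directly. *)
  move/mapP: pW => [p' pV ep]; move/mapP: qW => [q' qV eq].
  move/mapP: rW => [r' rV er]; move/mapP: sW => [s' sV es].
  rewrite {}ep {}eq {}er {}es in h1 h2 h3.
  have LD (D : int) : L < D -> ((l / 2)%:E < (D%:~R / 2)%:E :> \bar R)%E.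
    move=> LD; rewrite lte_fin ltr_pM2r ?invr_gt0 ?ltr0n //.
    by apply: le_lt_trans lL _; rewrite ltr_int.
  case: (orient_unimap uphi) => H; rewrite !H in h1 h2 h3.
    by apply: lt_le_trans (LD _ h3) _; rewrite PV; exact: area2_hull_quad.
  (* When [phi] reverses orientation, [r'] and [s'] exchange roles. *)
  have h4 : L < orient p' q' s' - orient p' q' r' by lia.
  apply: lt_le_trans (LD _ h4) _; rewrite PV.
  by apply: area2_hull_quad => //; lia.
- have eqv : lattice_equiv P (hull [:: pt 0 0; pt k%:~R 0; pt 0 1]).
    by exists A, v; split; rewrite // imP; exact: hull_thin.
  have k1R : 1 <= k%:~R :> R by rewrite ler1z.
  have aE := area2_model (or_introl (conj k1R eqv)).
  have lk : l <= k%:~R.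
    apply: lsle; last by lia.
    by move=> [x y] /HW; rewrite /in_zDelta /=; nia.
  by apply: tight aE lk => e; left; rewrite e.
- have eqv : lattice_equiv P [set p | 0 <= p.1 <= 1 /\ 0 <= p.2 <= 1].
    by exists A, v; split; rewrite // imP; exact: hull_square.
  have aE := area2_model (or_intror (or_introl (conj (erefl (2 : R)) eqv))).
  have lk : l <= 2.
    apply: (lsle 2) => // -[x y] zW; have [_ _ _ _ /(_ _ _ zW)] := sqW.
    by rewrite /in_zDelta /=; lia.
  by apply: tight aE lk => e; right; left.
have eqv : lattice_equiv P (hull [:: pt 0 0; pt 1 2; pt 2 1]).
  by exists A, v; split; rewrite // imP; exact: hull_central.
have aE := area2_model (or_intror (or_intror (conj (erefl (3 : R)) eqv))).
have lk : l <= 3.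
  apply: (lsle 3) => // z zW; have [_ _ _ /(_ _ zW)] := cW.
  by rewrite !inE => /or4P[] /eqP ->.
by apply: tight aE lk => e; right; right.
Qed.
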